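(* Let $a\in\mathbb{R}^{n\times m}_+$ have no zero row and no zero column, $B\in\mathbb{R}^n_{>0}$, $\mathcal{P}=\{p\in\mathbb{R}^m_+:\sum_jp_j=\|B\|_1\}$, $\bar r_i=\|B\|_1\|a_i\|_\infty$, $\underline r_i=B_i\|a_i\|_\infty$. Define $\tilde h(r)=\sum_i\tilde h_i(r_i)$ where $\tilde h_i(r_i)=-B_i\log r_i$ for $r_i>\underline r_i$ and $\tilde h_i(r_i)=\frac{B_i}{2\underline r_i^2}(r_i-\underline r_i)^2-\frac{B_i}{\underline r_i}(r_i-\underline r_i)-B_i\log\underline r_i$ for $r_i\le\underline r_i$. Let $\mu=\min_i\frac{B_i}{\bar r_i^2}$, $L=\max_i\frac{B_i}{\underline r_i^2}$, $F(p)=\tilde h(ap)$, $F^*=\min_{p\in\mathcal{P}}F$. Then projected gradient $p^{t+1}=\Pi_{\mathcal{P}}(p^t-\frac{1}{L\|a\|^2}\nabla F(p^t))$ from $p^0\in\mathcal{P}$ satisfies $$F(p^t)-F^*\le\left(1-\frac{\mu}{\max\{\mu,\,LH_{\mathcal{P}}(a)^2\|a\|^2\}}\right)^t(F(p^0)-F^* )\quad\forall t\ge0.$$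
   Context: $a_i$ is the $i$-th row of $a$; $\|a\|$ is the spectral norm; $\Pi_{\mathcal{P}}$ Euclidean projection. Hoffman constant: $H_{\mathcal{X}}(A)$ is the smallest $H>0$ such that for every $z$ with $\mathcal{X}\cap\{x:Ax=z\}\neq\emptyset$, setting $\mathcal{S}=\{x:Ax=z\}$, $\|x-\Pi_{\mathcal{X}\cap\mathcal{S}}(x)\|\le H\|Ax-z\|$ for all $x\in\mathcal{X}$. *)

(* Defs.v *)
From HB Require Import structures.
From mathcomp Require Import all_boot all_order all_algebra.
From mathcomp Require Import all_classical all_reals all_analysis.
Set Implicit Arguments. Unset Strict Implicit. Unset Printing Implicit Defensive.
Import Order.TTheory GRing.Theory Num.Theory.
Local Open Scope classical_set_scope.
Local Open Scope ring_scope.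

Section Defs.
Variable R : realType.

Definition enorm (k : nat) (v : 'cV[R]_k) : R := Num.sqrt (\sum_i (v i 0) ^+ 2).

Definition specnorm (n m : nat) (a : 'M[R]_(n, m)) : R :=
  sup [set enorm (a *m x) | x in [set x : 'cV[R]_m | enorm x <= 1]].

Definition is_proj (k : nat) (X : set 'cV[R]_k) (x y : 'cV[R]_k) : Prop :=
  X y /\ forall z, X z -> enorm (x - y) <= enorm (x - z).

Definition hoffman_prop (n m : nat) (X : set 'cV[R]_m) (A : 'M[R]_(n, m)) (H : R) : Prop :=
  0 < H /\
  forall z : 'cV[R]_n,
    (exists x, X x /\ A *m x = z) ->
    forall x, X x -> forall y, is_proj [set w | X w /\ A *m w = z] x y ->
      enorm (x - y) <= H * enorm (A *m x - z).

Definition hoffman (n m : nat) (X : set 'cV[R]_m) (A : 'M[R]_(n, m)) : R :=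
  inf [set H | hoffman_prop X A H].

Definition rowinf (n m : nat) (a : 'M[R]_(n, m)) (i : 'I_n) : R :=
  \big[Num.max/0]_(j < m) `|a i j|.

Definition norm1 (n : nat) (B : 'cV[R]_n) : R := \sum_i `|B i 0|.

Definition rbar (n m : nat) (a : 'M[R]_(n, m)) (B : 'cV[R]_n) (i : 'I_n) : R :=
  norm1 B * rowinf a i.
Definition rlow (n m : nat) (a : 'M[R]_(n, m)) (B : 'cV[R]_n) (i : 'I_n) : R :=
  B i 0 * rowinf a i.

Definition Pset (n m : nat) (B : 'cV[R]_n) : set 'cV[R]_m :=
  [set p | (forall j, 0 <= p j 0) /\ \sum_j p j 0 = norm1 B].

Definition htilde_i (Bi rl ri : R) : R :=
  if rl < ri then - (Bi * ln ri)
  else Bi / (2 * rl ^+ 2) * (ri - rl) ^+ 2 - Bi / rl * (ri - rl) - Bi * ln rl.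

Definition htilde (n m : nat) (a : 'M[R]_(n, m)) (B : 'cV[R]_n) (r : 'cV[R]_n) : R :=
  \sum_i htilde_i (B i 0) (rlow a B i) (r i 0).

Definition Fobj (n m : nat) (a : 'M[R]_(n, m)) (B : 'cV[R]_n) (p : 'cV[R]_m) : R :=
  htilde a B (a *m p).

Definition mu_const (n m : nat) (a : 'M[R]_(n, m)) (B : 'cV[R]_n) : R :=
  inf [set B i 0 / (rbar a B i) ^+ 2 | i in [set: 'I_n]].
Definition L_const (n m : nat) (a : 'M[R]_(n, m)) (B : 'cV[R]_n) : R :=
  sup [set B i 0 / (rlow a B i) ^+ 2 | i in [set: 'I_n]].

Definition grad (m : nat) (f : 'cV[R]_m -> R) (p : 'cV[R]_m) : 'cV[R]_m :=
  \col_j derive1 (fun s : R => f (p + s *: delta_mx j 0)) 0.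

End Defs.

(* Main.v *)
(* Write [F p = h (a p)] with [h] separable, [mu]-strongly convex on the image of
   the simplex [P] and [L]-smooth.  For [x] in [P], let [y] be the projection of
   [x] on the points of [P] having the same image under [a] as a minimizer.  Then
   [F* >= F x + <grad F x, y - x> + mu/2 |a (y - x)|^2], and the Hoffman bound
   [|y - x| <= H |a (y - x)|] makes the last term quadratic in [y - x].  The
   projected gradient step minimizes over [P] the quadratic model of [F] at [x]
   with curvature [L |a|^2], which majorizes [F]; testing that model at
   [x + s (y - x)], [s = mu / max (mu, L H^2 |a|^2)], yields
   [F x+ - F* <= (1 - s) (F x - F* )].

   The Hoffman constant is finite: after subtracting from [q - x] all kernel
   vectors of [a] with conforming signs, what remains lies in one of finitely many
   closed cones on which [a] is injective, and compactness bounds [|u| / |a u|]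
   on each of them. *)
Require Import Defs.
From HB Require Import structures.
From mathcomp Require Import all_boot all_order all_algebra.
From mathcomp Require Import all_classical all_reals all_analysis.
From mathcomp Require Import ring lra.
Import Order.TTheory GRing.Theory Num.Theory.
Import numFieldNormedType.Exports.
Local Open Scope classical_set_scope.
Local Open Scope ring_scope.

(** * Scalar estimates: derivative, strong convexity and smoothness of [htilde_i] *)

Section RealFunctions.
Set Implicit Arguments.
Unset Strict Implicit.
Variable R : realType.

(** Subtracting the tangent at [x] and the quadratic term leaves [g], whose derivative is
    nonpositive before [x] and nonnegative from [x] to [b], so [x] minimizes [g] up to [b]. The sign
    of [c] is free: a negative [c] later yields smoothness. *)
Lemma quadratic_lower_bound (f df : R -> R) (c b x y : R) :
  (forall t : R, is_derive t (1:R) f (df t)) ->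
  (forall s t, s <= t -> t <= b -> c * (t - s) <= df t - df s) ->
  x <= b -> y <= b ->
  f x + df x * (y - x) + c / 2 * (y - x) ^+ 2 <= f y.
Proof.
move=> fD dfc xb yb.
pose g (t : R) := f t - df x * t - c / 2 * (t - x) ^+ 2.
pose dg (t : R) := df t - df x - c * (t - x).
have gD (t : R) : is_derive t (1:R) g (dg t).
  have -> : g = f - (df x) \*: id - (c / 2) \*: ((id - cst x) ^+ 2).
    by apply/funext => s; rewrite /g !fctE.
  apply: is_derive_eq.
  rewrite /dg !fctE /= subr0 /GRing.scale /= !mulr1 expr1; by field.
have gC (A : set R) : {within A, continuous g}.
  apply: continuous_subspaceT => t.
  apply: differentiable_continuous; apply/derivable1_diffP.
  exact: (@ex_derive _ _ _ _ _ _ _ (gD t)).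
suff : g x <= g y.
  rewrite /g subrr expr0n /= mulr0 subr0 => h.
  rewrite -subr_ge0; rewrite -subr_ge0 in h.
  by apply: le_trans h _; rewrite le_eqVlt; apply/orP; left; apply/eqP; ring.
have [xy|yx|->//] := ltgtP x y.
- have [z /[!in_itv]/= /andP[xz zy] gE] := MVT xy (fun t _ => gD t) (gC _).
  rewrite -subr_ge0 gE mulr_ge0 ?subr_ge0 ?(ltW xy)//.
  by apply: dfc; [exact: ltW|exact: le_trans (ltW zy) yb].
- have [z /[!in_itv]/= /andP[yz zx] gE] := MVT yx (fun t _ => gD t) (gC _).
  rewrite -subr_le0 gE mulr_le0_ge0 ?subr_ge0 ?(ltW yx)//.
  have := dfc _ _ (ltW zx) xb; rewrite /dg -(opprB x z) -(opprB (df x)).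
  by rewrite mulrN; lra.
Qed.

(** Every difference quotient of [f] at [x] is one of [g1] or of [g2], and both tend to [l]. *)
Lemma is_derive_glue (f g1 g2 : R -> R) (x l : R) :
  (forall t, f t = g1 t \/ f t = g2 t) -> f x = g1 x -> f x = g2 x ->
  is_derive x (1:R) g1 l -> is_derive x (1:R) g2 l -> is_derive x (1:R) f l.
Proof.
move=> fg fg1 fg2 g1D g2D.
have Q (g : R -> R) : is_derive x (1:R) g l ->
    (fun h => h^-1 *: ((g \o shift x) (h *: 1) - g x)) @ 0^' --> l.
  by move=> [gD gl]; rewrite -gl; exact: gD.
have fl : (fun h => h^-1 *: ((f \o shift x) (h *: 1) - f x)) @ 0^' --> l.
  apply/cvgrPdist_lt => e e0.
  move/cvgrPdist_lt : (Q _ g1D) => /(_ _ e0) H1.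
  move/cvgrPdist_lt : (Q _ g2D) => /(_ _ e0) H2.
  near=> h.
  have h1 : `|l - h^-1 *: ((g1 \o shift x) (h *: 1) - g1 x)| < e.
    by near: h; exact: H1.
  have h2 : `|l - h^-1 *: ((g2 \o shift x) (h *: 1) - g2 x)| < e.
    by near: h; exact: H2.
  rewrite /=; have [->|->] := fg (h *: 1 + x); first by rewrite fg1.
  by rewrite fg2.
apply: DeriveDef; first by apply/cvg_ex; exists l.
exact/cvg_lim.
Unshelve. all: by end_near.
Qed.

Definition dhtilde_i (Bi rl ri : R) : R :=
  if rl < ri then - (Bi / ri) else Bi / rl ^+ 2 * (ri - rl) - Bi / rl.

Lemma is_derive_htilde_i (Bi rl x : R) : 0 < rl ->
  is_derive x (1:R) (htilde_i Bi rl) (dhtilde_i Bi rl x).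
Proof.
move=> rl0.
pose g1 (t : R) := - (Bi * ln t).
pose g2 (t : R) :=
  Bi / (2 * rl ^+ 2) * (t - rl) ^+ 2 - Bi / rl * (t - rl) - Bi * ln rl.
have g1D (t : R) : 0 < t -> is_derive t (1:R) g1 (- (Bi / t)).
  move=> t0; have -> : g1 = - (Bi \*: @ln R) by apply/funext => s; rewrite !fctE.
  have lnD := is_derive1_ln t0.
  by apply: is_derive_eq.
have g2D (t : R) : is_derive t (1:R) g2 (Bi / rl ^+ 2 * (t - rl) - Bi / rl).
  have -> : g2 = (Bi / (2 * rl ^+ 2)) \*: ((id - cst rl) ^+ 2)
      - (Bi / rl) \*: (id - cst rl) - cst (Bi * ln rl).
    by apply/funext => s; rewrite /g2 !fctE.
  apply: is_derive_eq; rewrite !fctE /= !subr0 /GRing.scale /= !mulr1 expr1.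
  by field; rewrite gt_eqF.
rewrite /dhtilde_i; case: (ltgtP rl x) => [rx|xr|<-].
- apply: near_eq_is_derive (g1D x (lt_trans rl0 rx)).
  by near=> t; rewrite /htilde_i ifT//; near: t; exact: lt_nbhsr.
- apply: near_eq_is_derive (g2D x).
  near=> t; rewrite /htilde_i ifF//; apply/negbTE; rewrite -leNgt.
  by apply/ltW; near: t; exact: lt_nbhsl.
(* At the junction both branches have value [- Bi * ln rl] and slope [- Bi / rl]: the quadratic is
   the second-order Taylor polynomial of the logarithmic branch at [rl]. *)
- apply: (@is_derive_glue _ g1 g2) => //.
  + by move=> t; rewrite /htilde_i; case: ifP; [left|right].
  + by rewrite /htilde_i ltxx subrr expr0n /= !mulr0 subrr sub0r.
  + by rewrite /htilde_i ltxx.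
  + by rewrite subrr mulr0 sub0r; exact: g1D.
Unshelve. all: by end_near.
Qed.

(** On either branch the derivative grows at a rate [Bi / (u * v)] with [u] and [v] in [(0, b]],
    hence at least [Bi / b ^+ 2]. *)
Lemma dhtilde_i_strongly_monotone (Bi rl b s t : R) :
  0 < Bi -> 0 < rl -> rl <= b -> s <= t -> t <= b ->
  Bi / b ^+ 2 * (t - s) <= dhtilde_i Bi rl t - dhtilde_i Bi rl s.
Proof.
move=> B0 r0 rb st tb; have b0 := lt_le_trans r0 rb.
have inv (x y : R) : 0 < x -> x <= b -> 0 < y -> y <= b ->
    Bi / b ^+ 2 <= Bi / (x * y).
  move=> x0 xb y0 yb; rewrite ler_pM2l // lef_pV2 ?posrE ?mulr_gt0//.
  by rewrite expr2 ler_pM// ltW.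
rewrite /dhtilde_i; have [rt|tr] := ltP rl t; have [rs|sr] := ltP rl s.
- have s0 := lt_trans r0 rs; have t0 := lt_trans r0 rt.
  have -> : - (Bi / t) - - (Bi / s) = Bi / (s * t) * (t - s).
    by field; rewrite !gt_eqF.
  by rewrite ler_wpM2r ?subr_ge0// inv// (le_trans st).
(* Here [s <= rl < t]: the increment is split at [rl], and [inv] bounds the rate on each piece. *)
- have t0 := lt_trans r0 rt.
  have -> : - (Bi / t) - (Bi / rl ^+ 2 * (s - rl) - Bi / rl) =
     Bi / (rl * t) * (t - rl) + Bi / (rl * rl) * (rl - s).
    by field; rewrite !gt_eqF.
  have -> : t - s = (t - rl) + (rl - s) by ring.
  rewrite mulrDr lerD// ler_wpM2r ?subr_ge0 ?inv// ltW//.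
- by have := lt_le_trans rs st; rewrite ltNge tr.
- have -> : Bi / rl ^+ 2 * (t - rl) - Bi / rl -
      (Bi / rl ^+ 2 * (s - rl) - Bi / rl) = Bi / (rl * rl) * (t - s).
    by field; rewrite gt_eqF.
  by rewrite ler_wpM2r ?subr_ge0// inv.
Qed.

(** The rates are the same quotients [Bi / (u * v)], now bounded above because [u] and [v] are at
    least [rl]. *)
Lemma dhtilde_i_lipschitz (Bi rl s t : R) : 0 < Bi -> 0 < rl -> s <= t ->
  dhtilde_i Bi rl t - dhtilde_i Bi rl s <= Bi / rl ^+ 2 * (t - s).
Proof.
move=> B0 r0 st.
have inv (x y : R) : rl <= x -> rl <= y -> Bi / (x * y) <= Bi / rl ^+ 2.
  move=> rx ry; have x0 := lt_le_trans r0 rx; have y0 := lt_le_trans r0 ry.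
  rewrite ler_pM2l // lef_pV2 ?posrE ?mulr_gt0//.
  by rewrite expr2 ler_pM// ltW.
rewrite /dhtilde_i; have [rt|tr] := ltP rl t; have [rs|sr] := ltP rl s.
- have s0 := lt_trans r0 rs; have t0 := lt_trans r0 rt.
  have -> : - (Bi / t) - - (Bi / s) = Bi / (s * t) * (t - s).
    by field; rewrite !gt_eqF.
  by rewrite ler_wpM2r ?subr_ge0// inv// ltW.
- have t0 := lt_trans r0 rt.
  have -> : - (Bi / t) - (Bi / rl ^+ 2 * (s - rl) - Bi / rl) =
     Bi / (rl * t) * (t - rl) + Bi / (rl * rl) * (rl - s).
    by field; rewrite !gt_eqF.
  have -> : t - s = (t - rl) + (rl - s) by ring.
  rewrite [leRHS]mulrDr lerD// ler_wpM2r ?subr_ge0 ?inv// ltW//.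
- by have := lt_le_trans rs st; rewrite ltNge tr.
- have -> : Bi / rl ^+ 2 * (t - rl) - Bi / rl -
      (Bi / rl ^+ 2 * (s - rl) - Bi / rl) = Bi / (rl * rl) * (t - s).
    by field; rewrite gt_eqF.
  by rewrite ler_wpM2r ?subr_ge0// inv.
Qed.

Lemma htilde_i_strongly_convex (Bi rl b x y : R) :
  0 < Bi -> 0 < rl -> rl <= b -> x <= b -> y <= b ->
  htilde_i Bi rl x + dhtilde_i Bi rl x * (y - x)
    + Bi / b ^+ 2 / 2 * (y - x) ^+ 2 <= htilde_i Bi rl y.
Proof.
move=> B0 r0 rb xb yb; apply: quadratic_lower_bound xb yb => [t|s t st tb].
  exact: is_derive_htilde_i.
exact: dhtilde_i_strongly_monotone.
Qed.

(** This is [quadratic_lower_bound] for [- htilde_i] with the constant [- (Bi / rl ^+ 2)]. The slope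
    bound holds on the whole line, so [Num.max x y] can serve as [b]. *)
Lemma htilde_i_smooth (Bi rl x y : R) : 0 < Bi -> 0 < rl ->
  htilde_i Bi rl y <= htilde_i Bi rl x + dhtilde_i Bi rl x * (y - x)
    + Bi / rl ^+ 2 / 2 * (y - x) ^+ 2.
Proof.
move=> B0 r0.
have ND (t : R) : is_derive t (1:R) (- htilde_i Bi rl) (- dhtilde_i Bi rl t).
  by have hD := is_derive_htilde_i Bi t r0; apply: is_derive_eq.
have xm : x <= Num.max x y by rewrite le_max lexx.
have ym : y <= Num.max x y by rewrite le_max lexx orbT.
have : forall s t, s <= t -> t <= Num.max x y ->
    - (Bi / rl ^+ 2) * (t - s) <= - dhtilde_i Bi rl t - - dhtilde_i Bi rl s.
  by move=> s t st _; have := dhtilde_i_lipschitz B0 r0 st; lra.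
move=> /(quadratic_lower_bound ND)/(_ xm ym); rewrite !fctE; lra.
Qed.

End RealFunctions.

(** * Euclidean norm, closed sets and compactness for column vectors *)

Section EuclideanNorm.
Set Implicit Arguments.
Unset Strict Implicit.
Variables (R : realType).

Definition dotp (k : nat) (u v : 'cV[R]_k) : R := \sum_i u i 0 * v i 0.

Lemma enorm_ge0 k (u : 'cV[R]_k) : 0 <= enorm u.
Proof. exact: sqrtr_ge0. Qed.

Lemma sqr_enorm k (u : 'cV[R]_k) : enorm u ^+ 2 = \sum_i u i 0 ^+ 2.
Proof. by rewrite /enorm sqr_sqrtr// sumr_ge0// => i _; exact: sqr_ge0. Qed.

Lemma ler_enorm k l (u : 'cV[R]_k) (v : 'cV[R]_l) :
  (enorm u <= enorm v) = (enorm u ^+ 2 <= enorm v ^+ 2).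
Proof. by rewrite ler_sqr// nnegrE enorm_ge0. Qed.

Lemma enorm0 k : enorm (0 : 'cV[R]_k) = 0.
Proof. by rewrite /enorm big1 ?sqrtr0// => i _; rewrite mxE expr0n. Qed.

Lemma enorm_eq0 k (u : 'cV[R]_k) : (enorm u == 0) = (u == 0).
Proof.
apply/eqP/eqP => [u0|->]; last exact: enorm0.
have /eqP : \sum_i u i 0 ^+ 2 = 0 by rewrite -sqr_enorm u0 expr0n.
rewrite psumr_eq0 => [/allP z|i _]; last exact: sqr_ge0.
apply/colP => i; rewrite mxE; apply/eqP.
by rewrite -(sqrf_eq0 (u i 0)); exact: z (mem_index_enum _).
Qed.

Lemma enormZ k (c : R) (u : 'cV[R]_k) : enorm (c *: u) = `|c| * enorm u.
Proof.
rewrite /enorm -sqrtr_sqr -sqrtrM ?sqr_ge0// mulr_sumr; congr Num.sqrt.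
by apply: eq_bigr => i _; rewrite mxE exprMn.
Qed.

Lemma enormB k (u v : 'cV[R]_k) : enorm (u - v) = enorm (v - u).
Proof. by rewrite -opprB -scaleN1r enormZ normrN1 mul1r. Qed.

Lemma sqr_enormD k (u v : 'cV[R]_k) :
  enorm (u + v) ^+ 2 = enorm u ^+ 2 + 2 * dotp u v + enorm v ^+ 2.
Proof.
rewrite !sqr_enorm /dotp mulr_sumr -!big_split /=; apply: eq_bigr => i _.
by rewrite mxE; ring.
Qed.

Lemma dotpZl k c (u v : 'cV[R]_k) : dotp (c *: u) v = c * dotp u v.
Proof. by rewrite mulr_sumr; apply: eq_bigr => i _; rewrite mxE mulrA. Qed.

Lemma dotpZr k c (u v : 'cV[R]_k) : dotp u (c *: v) = c * dotp u v.
Proof. by rewrite mulr_sumr; apply: eq_bigr => i _; rewrite mxE mulrCA. Qed.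

Lemma ler_coord_enorm k (u : 'cV[R]_k) i : `|u i 0| <= enorm u.
Proof.
rewrite -ler_sqr ?nnegrE ?enorm_ge0// real_normK ?num_real// sqr_enorm.
by rewrite (bigD1 i)//= lerDl sumr_ge0// => j _; exact: sqr_ge0.
Qed.

Lemma enorm_le_sum k (u : 'cV[R]_k) : enorm u <= \sum_i `|u i 0|.
Proof.
rewrite -ler_sqr ?nnegrE ?enorm_ge0 ?sumr_ge0// sqr_enorm expr2 mulr_suml.
apply: ler_sum => i _; rewrite -real_normK ?num_real// expr2 ler_wpM2l//.
by rewrite (bigD1 i)//= lerDl sumr_ge0.
Qed.

Lemma sum_continuous (T : topologicalType) k (F : 'I_k -> T -> R) :
  (forall i, continuous (F i)) -> continuous (fun x => \sum_i F i x).
Proof.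
move=> FC; apply: continuous_big => [|i _]; last exact: FC.
exact: add_continuous.
Qed.

Lemma enorm_continuous k : continuous (@enorm R k).
Proof.
move=> x; apply: (@continuous_comp _ _ _ (fun v : 'cV[R]_k => \sum_i v i 0 ^+ 2)
  Num.sqrt); last exact: sqrt_continuous.
apply: sum_continuous => {x} i x.
apply: (@continuous_comp _ _ _ (fun v : 'cV[R]_k => v i 0) (fun t => t ^+ 2)).
  exact: coord_continuous.
exact: exprn_continuous.
Qed.

Lemma mulmx_continuous n k (A : 'M[R]_(n, k)) :
  continuous (fun x : 'cV[R]_k => A *m x).
Proof.
move=> x S [P Px PS]; rewrite nbhs_filterE.
have Px' i : nbhs x (fun y : 'cV[R]_k => P i 0 ((A *m y) i 0)).
  have : continuous (fun y : 'cV[R]_k => (A *m y) i 0).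
    move=> y; rewrite (_ : (fun y => _) =
      (fun y : 'cV[R]_k => \sum_j A i j * y j 0)).
      apply: sum_continuous => {y} j y; apply: continuousM.
        exact: cst_continuous.
      exact: coord_continuous.
    by apply/funext => z; rewrite mxE.
  by move=> /(_ x) /(_ _ (Px i 0)).
have /(_ (nbhs_filter x)) := @filter_forall _ _ _ (nbhs x) _ Px'.
by apply: filterS => y Py; apply: PS => i j; rewrite ord1; exact: Py.
Qed.

Lemma closed_coord_ge k (i : 'I_k) : closed [set x : 'cV[R]_k | 0 <= x i 0].
Proof.
apply: (@closed_comp _ _ (fun x : 'cV[R]_k => x i 0) [set t | 0 <= t]).
  by move=> x _; exact: coord_continuous.
exact: closed_ge.
Qed.

Lemma closed_coord_le k (i : 'I_k) : closed [set x : 'cV[R]_k | x i 0 <= 0].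
Proof.
apply: (@closed_comp _ _ (fun x : 'cV[R]_k => x i 0) [set t | t <= 0]).
  by move=> x _; exact: coord_continuous.
exact: closed_le.
Qed.

Lemma closed_coord_sum k (c : R) : closed [set x : 'cV[R]_k | \sum_i x i 0 = c].
Proof.
apply: (@closed_comp _ _ (fun x : 'cV[R]_k => \sum_i x i 0) [set t | t = c]).
  by move=> x _; apply: sum_continuous => i; exact: coord_continuous.
exact: closed_eq.
Qed.

Lemma closed_enorm_eq k (c : R) : closed [set x : 'cV[R]_k | enorm x = c].
Proof.
apply: (@closed_comp _ _ (@enorm R k) [set t | t = c]).
  by move=> x _; exact: enorm_continuous.
exact: closed_eq.
Qed.

Lemma closed_mulmx_eq n k (A : 'M[R]_(n, k)) (z : 'cV[R]_n) :
  closed [set x : 'cV[R]_k | A *m x = z].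
Proof.
rewrite (_ : mkset _ = (fun x => A *m x - z) @^-1` [set w | enorm w = 0]).
  apply: closed_comp => [x _|]; last exact: closed_enorm_eq.
  apply: (@continuousB _ _ _ (mulmx A) (cst z)); first exact: mulmx_continuous.
  exact: cst_continuous.
apply/seteqP; split => x /= => [->|/eqP]; first by rewrite subrr enorm0.
by rewrite enorm_eq0 subr_eq0 => /eqP.
Qed.

Lemma trmx_continuous n k : continuous (@trmx R n k).
Proof.
move=> x S [P Px PS]; exists (fun i j => P j i) => [i j|y Py].
  by have := Px j i; rewrite mxE.
by apply: PS => i j; rewrite mxE; exact: Py.
Qed.

(** The extreme value theorem is applied to row vectors, hence the passage through [trmx];
    boundedness transfers since the sup norm is at most [enorm]. *)
Lemma closed_bounded_min k (A : set 'cV[R]_k) (f : 'cV[R]_k -> R) (M : R) :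
  A !=set0 -> closed A -> (forall x, A x -> enorm x <= M) -> continuous f ->
  exists2 c, A c & forall x, A x -> f c <= f x.
Proof.
move=> [x0 Ax0] Acl AM fC.
pose A' := (@trmx R 1 k) @^-1` A.
have A'cl : closed A'.
  by apply: closed_comp => // x _; exact: trmx_continuous.
have A'bd : bounded_set A'.
  exists M; split => [|N MN v A'v]; first exact: num_real.
  rewrite /Num.norm/= mx_normrE; apply/bigmax_leP; split => [|[i j] _ /=].
    apply: le_trans (ltW MN); exact: le_trans (enorm_ge0 _) (AM _ A'v).
  apply: le_trans (ltW MN); apply: le_trans (AM _ A'v).
  by have := ler_coord_enorm v^T j; rewrite mxE ord1.
have [||c /[!inE] Ac cmin] := @EVT_min_rV R k (f \o trmx) A' _
    (bounded_closed_compact A'bd A'cl).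
- by exists x0^T; rewrite /A' /= trmxK.
- apply: continuous_subspaceT => x; apply: continuous_comp.
    exact: trmx_continuous.
  exact: fC.
exists c^T => // x Ax; have /= := cmin x^T; rewrite trmxK; apply.
by rewrite inE /A' /= trmxK.
Qed.

Lemma is_proj_exists k (A : set 'cV[R]_k) (M : R) (x : 'cV[R]_k) :
  A !=set0 -> closed A -> (forall y, A y -> enorm y <= M) ->
  exists y, is_proj A x y.
Proof.
move=> A0 Acl AM.
have [|c Ac cmin] := @closed_bounded_min k A (fun y => enorm (x - y)) M A0 Acl AM.
  move=> y.
  apply: (@continuous_comp _ _ _ (fun y : 'cV[R]_k => x - y) (@enorm R k)).
    apply: (@continuousB _ _ _ (cst x) id); first exact: cst_continuous.
    exact: cvg_id.
  exact: enorm_continuous.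
by exists c.
Qed.

(** By homogeneity unit vectors of [C] suffice. They form a compact set, on which [enorm (A *m u)]
    attains a minimum, positive by injectivity; [H] is its inverse. Without unit vectors, [C] has no
    nonzero element and any [H] works. *)
Lemma cone_error_bound n k (A : 'M[R]_(n, k)) (C : set 'cV[R]_k) :
  closed C -> (forall u (t : R), C u -> 0 <= t -> C (t *: u)) ->
  (forall u, C u -> A *m u = 0 -> u = 0) ->
  exists2 H, 0 < H & forall u, C u -> enorm u <= H * enorm (A *m u).
Proof.
move=> Ccl CZ Cinj.
pose S := C `&` [set u | enorm u = 1].
have CS u : C u -> u != 0 -> S ((enorm u)^-1 *: u).
  move=> Cu u0; split => /=; first by apply: CZ; rewrite // invr_ge0 enorm_ge0.
  rewrite enormZ ger0_norm ?invr_ge0 ?enorm_ge0// mulVf//.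
  by rewrite enorm_eq0.
have [S0|/set0P/negP/negPn/eqP S0] := pselect (S !=set0); last first.
  exists 1 => // u Cu; have [->|/(CS _ Cu)] := eqVneq u 0.
    by rewrite mulmx0 !enorm0 mulr0.
  by rewrite S0.
have [||||c [Cc c1] cmin] := @closed_bounded_min k S (fun u => enorm (A *m u)) 1.
- exact: S0.
- by apply: closedI => //; exact: closed_enorm_eq.
- by move=> x [_ ->].
- move=> x; apply: (@continuous_comp _ _ _ (mulmx A) (@enorm R n)).
    exact: mulmx_continuous.
  exact: enorm_continuous.
have c0 : 0 < enorm (A *m c).
  rewrite lt_neqAle enorm_ge0 andbT eq_sym enorm_eq0.
  apply/eqP => /(Cinj _ Cc) cz; move: c1; rewrite /= cz enorm0 => /eqP.
  by rewrite eq_sym oner_eq0.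
exists (enorm (A *m c))^-1; first by rewrite invr_gt0.
move=> u Cu; have [->|u0] := eqVneq u 0.
  by rewrite mulmx0 !enorm0 mulr0.
have u0' : 0 < enorm u by rewrite lt_neqAle enorm_ge0 eq_sym enorm_eq0 u0.
have := cmin _ (CS _ Cu u0).
rewrite -scalemxAr enormZ ger0_norm ?invr_ge0 ?enorm_ge0//.
by rewrite mulrC ler_pdivlMr// mulrC -ler_pdivlMr// mulrC.
Qed.

End EuclideanNorm.

(** * Finiteness of the Hoffman constant of the simplex *)

Section Hoffman.
Set Implicit Arguments.
Unset Strict Implicit.
Variable R : realType.

(** Conformality puts [x + u] coordinatewise between [x] and [x + d], so it is nonnegative when
    these two are. *)
Definition conformal (k : nat) (u d : 'cV[R]_k) : Prop :=
  forall j, 0 <= u j 0 <= d j 0 \/ d j 0 <= u j 0 <= 0.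

(** In particular [u] vanishes wherever [d] does; magnitudes are not compared. *)
Definition sign_compatible (k : nat) (u d : 'cV[R]_k) : Prop :=
  forall j, (0 < u j 0 -> 0 < d j 0) /\ (u j 0 < 0 -> d j 0 < 0).

Lemma conformal_refl k (d : 'cV[R]_k) : conformal d d.
Proof.
by move=> j; have [d0|/ltW d0] := leP 0 (d j 0); [left|right]; rewrite ?d0 lexx.
Qed.

Lemma conformal_trans k (d v u : 'cV[R]_k) :
  conformal u v -> conformal v d -> conformal u d.
Proof. by move=> uv vd j; have := uv j; have := vd j; lra. Qed.

(** The step [t] is the smallest ratio [d j 0 / u j 0] over the support of [u]: no coordinate
    changes sign, and one attaining the minimum becomes zero. *)
Lemma conformal_step k (d u : 'cV[R]_k) : sign_compatible u d -> u != 0 ->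
  exists t, conformal (d - t *: u) d /\
    (#|[pred j | ((d - t *: u) j 0 != 0)%R]| < #|[pred j | (d j 0 != 0)%R]|)%N.
Proof.
move=> ud u0.
have [j0 uj0] : exists j, u j 0 != 0.
  apply/existsP; apply: contraNT u0; rewrite negb_exists => /forallP u0.
  by apply/eqP/colP => j; rewrite mxE; apply/eqP; have := u0 j; rewrite negbK.
have ud0 j : u j 0 != 0 -> 0 < d j 0 / u j 0.
  move=> uj; have [dp dn] := ud j.
  case: (ltgtP (u j 0) 0) uj => // uj _.
    by rewrite nmulr_rgt0 ?invr_lt0// dn.
  by rewrite divr_gt0// dp.
case: (@Order.TotalTheory.arg_minP _ _ _ j0 (fun j => u j 0 != 0)
  (fun j => d j 0 / u j 0) uj0) => i ui imin.
set t := d i 0 / u i 0 in imin *.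
have t0 : 0 < t by exact: ud0.
have cf : conformal (d - t *: u) d.
  move=> j; rewrite !mxE; have [dp dn] := ud j.
  have [uj|uj|uj] := ltgtP (u j 0) 0; last first.
  - by rewrite uj mulr0 subr0; exact: conformal_refl.
  - left; have := imin j; rewrite gt_eqF// => /(_ isT).
    by rewrite ler_pdivlMr// => h; have := mulr_gt0 t0 uj; lra.
  - right; have := imin j; rewrite lt_eqF// => /(_ isT).
    rewrite ler_ndivlMr// => h.
    by have := mulr_gt0 t0 (etrans (oppr_gt0 _) uj); lra.
exists t; split => //; apply: proper_card; apply/properP; split.
  apply/fintype.subsetP => j; rewrite !inE; apply: contraNneq => dj.
  by have := cf j; rewrite dj => -[|] /andP[h1 h2]; rewrite eq_le h1 h2.
have di : d i 0 != 0.
  by apply: contraTneq t0 => di; rewrite /t di mul0r ltxx.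
by exists i; rewrite !inE// !mxE /t divfK// subrr eqxx.
Qed.

(* Conformal kernel vectors are subtracted until none is left; each
   subtraction kills a coordinate. *)
Lemma conformal_reduction k (N : set 'cV[R]_k) (d : 'cV[R]_k) :
  N 0 -> (forall u v (c : R), N u -> N v -> N (u + c *: v)) ->
  exists d', [/\ conformal d' d, N (d - d') &
    forall u, N u -> sign_compatible u d' -> u = 0].
Proof.
move=> N0 ND.
have [l] := ubnP #|[pred j | d j 0 != 0]|.
elim: l d => // l IH d; rewrite ltnS => dl.
have [red|] := pselect (forall u, N u -> sign_compatible u d -> u = 0).
  by exists d; split; [exact: conformal_refl|rewrite subrr|].
move=> /existsNP[u /not_implyP[Nu /not_implyP[ud /eqP u0]]].
have [t [cf sz]] := conformal_step ud u0.
have [d' [d'e Nd' red]] := IH _ (leq_trans sz dl).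
exists d'; split => //; first exact: conformal_trans cf.
by rewrite (_ : d - d' = (d - t *: u - d') + t *: u);
  [exact: ND|rewrite addrAC subrK].
Qed.

(** The two flags of [s j] tell whether coordinate [j] may be positive and whether it may be
    negative. Weak inequalities keep the cone closed, the finite index type leaves finitely many
    cones, and the zero sum is that of a difference of two points of the simplex. *)
Definition sign_cone (k : nat) (s : {ffun 'I_k -> bool * bool}) : set 'cV[R]_k :=
  [set u | \sum_j u j 0 = 0] `&`
  \bigcap_(j in [set: 'I_k])
    ((if (s j).1 then setT else [set u | u j 0 <= 0]) `&`
     (if (s j).2 then setT else [set u | 0 <= u j 0])).

Lemma sign_cone_closed k (s : {ffun 'I_k -> bool * bool}) : closed (sign_cone s).
Proof.
apply: closedI; first exact: closed_coord_sum.
apply: closed_bigI => j _; apply: closedI; case: ifP => _.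
- exact: closedT.
- exact: closed_coord_le.
- exact: closedT.
- exact: closed_coord_ge.
Qed.

Lemma sign_coneZ k (s : {ffun 'I_k -> bool * bool}) (u : 'cV[R]_k) (t : R) :
  sign_cone s u -> 0 <= t -> sign_cone s (t *: u).
Proof.
move=> [u0 us] t0; split => /=.
  under eq_bigr do rewrite mxE.
  by rewrite -mulr_sumr u0 mulr0.
move=> j _; have [] := us j I.
case: ifP => _; case: ifP => _ //= h1 h2; split => //=;
  by rewrite !mxE ?mulr_ge0 ?mulr_ge0_le0.
Qed.

(** There are finitely many cones, so the sum of their constants serves all of them at once. *)
Lemma sign_cone_error_bound n k (a : 'M[R]_(n, k)) :
  exists2 H, 0 < H & forall s : {ffun 'I_k -> bool * bool},
    (forall u, sign_cone s u -> a *m u = 0 -> u = 0) ->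
    forall u, sign_cone s u -> enorm u <= H * enorm (a *m u).
Proof.
have /choice[f fP] : forall s : {ffun 'I_k -> bool * bool}, exists H, 0 < H /\
    ((forall u, sign_cone s u -> a *m u = 0 -> u = 0) ->
    forall u, sign_cone s u -> enorm u <= H * enorm (a *m u)).
  move=> s; have [inj|ninj] :=
    pselect (forall u, sign_cone s u -> a *m u = 0 -> u = 0).
    have [H H0 HP] :=
      cone_error_bound (@sign_cone_closed _ s) (@sign_coneZ _ s) inj.
    by exists H.
  (* A dummy value: the bound is only claimed for cones on which [a] is injective. *)
  by exists 1.
exists (1 + \sum_s f s).
  by rewrite ltr_pwDl// sumr_ge0// => s _; case: (fP s) => /ltW.
move=> s inj u us; have [_ /(_ inj u us) h] := fP s; apply: le_trans h _.
rewrite ler_wpM2r ?enorm_ge0// (bigD1 s)//= addrCA lerDl addr_ge0// sumr_ge0//.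
by move=> s' _; case: (fP s') => /ltW.
Qed.

Lemma sum_coordB k (u v : 'cV[R]_k) :
  \sum_j (u - v) j 0 = \sum_j u j 0 - \sum_j v j 0.
Proof. by rewrite -sumrB; apply: eq_bigr => j _; rewrite !mxE. Qed.

Lemma sum_coordDZ k (u v : 'cV[R]_k) (c : R) :
  \sum_j (u + c *: v) j 0 = \sum_j u j 0 + c * \sum_j v j 0.
Proof. by rewrite mulr_sumr -big_split; apply: eq_bigr => j _; rewrite !mxE. Qed.

(** The witness is [w = x + d], with [d] the conformal reduction of [q - x]: the image is that of
    [q], the coordinates lie between those of [x] and [q], and the sign cone of [d] contains no
    nonzero kernel vector. *)
Lemma Pset_error_bound n m (a : 'M[R]_(n, m)) (B : 'cV[R]_n) :
  exists2 H, 0 < H & forall x q, @Pset R n m B x -> @Pset R n m B q ->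
    exists w, [/\ @Pset R n m B w, a *m w = a *m q &
      enorm (x - w) <= H * enorm (a *m x - a *m q)].
Proof.
have [H H0 HP] := sign_cone_error_bound a.
exists H => // x q [x0 xB] [q0 qB].
(* Only kernel vectors of zero sum are removed, so that [x + d] keeps the total of [x]. *)
pose N := [set u : 'cV[R]_m | a *m u = 0 /\ \sum_j u j 0 = 0].
have N0 : N 0.
  by split; [rewrite mulmx0|rewrite big1// => j _; rewrite mxE].
have ND u v (c : R) : N u -> N v -> N (u + c *: v).
  move=> [au su] [av sv]; split.
    by rewrite mulmxDr -scalemxAr au av scaler0 addr0.
  by rewrite sum_coordDZ su sv mulr0 addr0.
have [d [dc [ad sd] red]] := conformal_reduction (q - x) N0 ND.
have {}ad : a *m d = a *m (q - x).
  by move/eqP: ad; rewrite mulmxBr subr_eq0 eq_sym => /eqP.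
have {}sd : \sum_j d j 0 = 0.
  move: sd; rewrite !sum_coordB xB qB subrr sub0r => /eqP.
  by rewrite oppr_eq0 => /eqP.
(* With the strict signs of [d] as flags, every vector of the cone is sign compatible with [d];
   [red] then gives injectivity. *)
pose s := [ffun j => (0 < d j 0, d j 0 < 0)].
have sdP : sign_cone s d.
  split => // j _; rewrite ffunE /=; split; case: ifP => //= /negbT.
    by rewrite -leNgt.
  by rewrite -leNgt.
have inj u : sign_cone s u -> a *m u = 0 -> u = 0.
  move=> [us uc] au; apply: red => // j; have [] := uc j I; rewrite ffunE /=.
  case: ifP => [dp _|_ /= up]; case: ifP => [dn _|_ /= un]; split => //= h; lra.
exists (x + d); split.
- split => [j|].
    have := dc j; have := x0 j; have := q0 j; rewrite !mxE; lra.
  by have := sum_coordDZ x d 1; rewrite scale1r mul1r sd addr0 xB.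
- by rewrite mulmxDr ad mulmxBr addrC subrK.
- rewrite opprD addNKr -scaleN1r enormZ normrN1 mul1r.
  by rewrite enormB -mulmxBr -ad; exact: (HP s inj d sdP).
Qed.

Lemma Pset_closed n m (B : 'cV[R]_n) : closed (@Pset R n m B).
Proof.
rewrite (_ : @Pset R n m B =
   \bigcap_(j in [set: 'I_m]) [set p : 'cV[R]_m | 0 <= p j 0]
   `&` [set p : 'cV[R]_m | \sum_j p j 0 = norm1 B]).
  by apply: closedI; [apply: closed_bigI => j _; exact: closed_coord_ge|
    exact: closed_coord_sum].
apply/seteqP; split => p /= [p0 pB]; split => // j.
  by move=> _; exact: p0.
exact: (p0 j I).
Qed.

Lemma Pset_bounded n m (B : 'cV[R]_n) (p : 'cV[R]_m) :
  Pset B p -> enorm p <= norm1 B.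
Proof.
move=> [p0 <-]; apply: le_trans (enorm_le_sum _) _.
by apply: ler_sum => j _; rewrite ger0_norm.
Qed.

Lemma is_proj_Pset_exists n m (a : 'M[R]_(n, m)) (B : 'cV[R]_n) (x q : 'cV[R]_m) :
  Pset B q ->
  exists y, is_proj [set w | @Pset R n m B w /\ a *m w = a *m q] x y.
Proof.
move=> Pq; apply: (@is_proj_exists R m _ (norm1 B)).
- by exists q.
- by apply: closedI; [exact: Pset_closed|exact: closed_mulmx_eq].
- by move=> y [/Pset_bounded].
Qed.

(* Nonemptiness of the set of admissible constants matters: [inf] of the empty
   set is [0]. *)
Lemma Pset_hoffman_prop n m (a : 'M[R]_(n, m)) (B : 'cV[R]_n) :
  exists H, hoffman_prop (@Pset R n m B) a H.
Proof.
have [H H0 HP] := Pset_error_bound a B.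
exists H; split => // z [q [Pq <-]] x Px y [_ ymin].
have [w [Pw aw xw]] := HP x q Px Pq.
by apply: le_trans xw; exact: ymin.
Qed.

Lemma hoffman_ge0 n m (X : set 'cV[R]_m) (a : 'M[R]_(n, m)) : 0 <= hoffman X a.
Proof.
have [|/set0P/negP/negPn/eqP e] := pselect ([set H | hoffman_prop X a H] !=set0).
  by move=> H0; apply: lb_le_inf => // H [/ltW].
by rewrite /hoffman e inf0.
Qed.

(** The infimum is itself admissible: for a positive residual, divide by it and pass to the infimum;
    for a zero residual, any admissible [H] already gives [enorm (x - y) <= 0]. *)
Lemma hoffmanP n m (X : set 'cV[R]_m) (a : 'M[R]_(n, m)) (q x y : 'cV[R]_m) :
  (exists H, hoffman_prop X a H) -> X q -> X x ->
  is_proj [set w | X w /\ a *m w = a *m q] x y ->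
  enorm (x - y) <= hoffman X a * enorm (a *m x - a *m q).
Proof.
move=> HX Xq Xx xy.
have bound H : hoffman_prop X a H -> enorm (x - y) <= H * enorm (a *m x - a *m q).
  by move=> [_ HP]; apply: HP xy => //; exists q.
have [e0|e0] := eqVneq (enorm (a *m x - a *m q)) 0.
  by case: HX => H /bound; rewrite e0 !mulr0.
have {}e0 : 0 < enorm (a *m x - a *m q) by rewrite lt_neqAle eq_sym e0 enorm_ge0.
rewrite -ler_pdivrMr//; apply: lb_le_inf => [|H /bound]; first exact: HX.
by rewrite ler_pdivrMr.
Qed.

End Hoffman.

(** * Spectral norm, the constants of the rate, and the projection step *)

Section ProjectedGradient.
Set Implicit Arguments.
Unset Strict Implicit.
Variable R : realType.

(** Boundedness ensures that the [sup] in [specnorm] is a genuine supremum. *)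
Lemma specnorm_has_ubound n m (a : 'M[R]_(n, m)) :
  has_ubound [set enorm (a *m x) | x in [set x : 'cV[R]_m | enorm x <= 1]].
Proof.
exists (\sum_i \sum_j `|a i j|) => _ [x /= x1 <-].
apply: le_trans (enorm_le_sum _) _; apply: ler_sum => i _; rewrite mxE.
apply: le_trans (ler_norm_sum _ _ _) _; apply: ler_sum => j _.
by rewrite normrM ler_piMr// (le_trans (ler_coord_enorm _ _)).
Qed.

Lemma enorm_mulmx_le n m (a : 'M[R]_(n, m)) (x : 'cV[R]_m) :
  enorm (a *m x) <= specnorm a * enorm x.
Proof.
have [->|x0] := eqVneq x 0; first by rewrite mulmx0 !enorm0 mulr0.
have {}x0 : 0 < enorm x by rewrite lt_neqAle eq_sym enorm_eq0 x0 enorm_ge0.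
rewrite -ler_pdivrMr//.
have <- : enorm (a *m ((enorm x)^-1 *: x)) = enorm (a *m x) / enorm x.
  by rewrite -scalemxAr enormZ ger0_norm ?invr_ge0 ?(ltW x0)// mulrC.
apply: ub_le_sup; first exact: specnorm_has_ubound.
exists ((enorm x)^-1 *: x) => //=.
by rewrite enormZ ger0_norm ?invr_ge0 ?(ltW x0)// mulVf ?lexx ?gt_eqF.
Qed.

Lemma specnorm_gt0 n m (a : 'M[R]_(n, m)) i j : a i j != 0 -> 0 < specnorm a.
Proof.
move=> aij; rewrite ltNge; apply/negP => a0.
have : enorm (a *m delta_mx j 0) <= 0.
  by apply: le_trans (enorm_mulmx_le _ _) _; rewrite mulr_le0_ge0// enorm_ge0.
rewrite le_eqVlt ltNge enorm_ge0 orbF enorm_eq0 => /eqP/colP/(_ i).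
by rewrite -colE !mxE; exact/eqP.
Qed.

Lemma ler_rowinf n m (a : 'M[R]_(n, m)) i j : `|a i j| <= rowinf a i.
Proof. exact: (le_bigmax _ (fun j => `|a i j|)). Qed.

Lemma rowinf_gt0 n m (a : 'M[R]_(n, m)) i j : a i j != 0 -> 0 < rowinf a i.
Proof. by rewrite -normr_gt0 => h; apply: lt_le_trans (ler_rowinf a i j). Qed.

Lemma ler_norm1 n (B : 'cV[R]_n) i : B i 0 <= norm1 B.
Proof.
apply: le_trans (ler_norm _) _.
by rewrite /norm1 (bigD1 i)//= lerDl sumr_ge0.
Qed.

(** This places the image of the simplex in the range where [htilde_i] has curvature at least
    [B i 0 / rbar a B i ^+ 2]. *)
Lemma mulmx_Pset_le n m (a : 'M[R]_(n, m)) (B : 'cV[R]_n) (p : 'cV[R]_m) i :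
  Pset B p -> (a *m p) i 0 <= rbar a B i.
Proof.
move=> [p0 pB]; rewrite mxE /rbar -pB mulr_suml; apply: ler_sum => j _.
rewrite mulrC ler_wpM2l//; exact: le_trans (ler_norm _) (ler_rowinf a i j).
Qed.

Lemma ler_L_const n m (a : 'M[R]_(n, m)) (B : 'cV[R]_n) i :
  B i 0 / rlow a B i ^+ 2 <= L_const a B.
Proof.
apply: ub_le_sup; last by exists i.
exists (\sum_i `|B i 0 / rlow a B i ^+ 2|) => _ [j _ <-].
apply: le_trans (ler_norm _) _.
by rewrite (bigD1 j)//= lerDl sumr_ge0.
Qed.

Lemma mu_const_ge0 n m (a : 'M[R]_(n, m)) (B : 'cV[R]_n) :
  (forall i, 0 < B i 0) -> 0 <= mu_const a B.
Proof.
move=> B0; rewrite /mu_const; set S := (X in inf X).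
have [S0|/set0P/negP/negPn/eqP ->] := pselect (S !=set0); last by rewrite inf0.
by apply: lb_le_inf => // _ [i _ <-]; rewrite divr_ge0 ?sqr_ge0// ltW.
Qed.

Lemma mu_const_le n m (a : 'M[R]_(n, m)) (B : 'cV[R]_n) i :
  (forall i, 0 < B i 0) -> mu_const a B <= B i 0 / rbar a B i ^+ 2.
Proof.
move=> B0; apply: ge_inf; last by exists i.
by exists 0 => _ [j _ <-]; rewrite divr_ge0 ?sqr_ge0// ltW.
Qed.

(* Comparing squared distances from [x - c^-1 *: g] gives the minimality of the
   projected point for the quadratic model of step [c^-1]. *)
Lemma is_proj_model_min k (X : set 'cV[R]_k) (x g z y : 'cV[R]_k) (c : R) :
  0 < c -> is_proj X (x - c^-1 *: g) z -> X y ->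
  dotp g (z - x) + c / 2 * enorm (z - x) ^+ 2 <=
  dotp g (y - x) + c / 2 * enorm (y - x) ^+ 2.
Proof.
move=> c0 [_ zmin] Xy; have := zmin y Xy; rewrite ler_enorm.
have E w : enorm (x - c^-1 *: g - w) ^+ 2 =
    enorm (c^-1 *: g) ^+ 2 + 2 / c * (dotp g (w - x) + c / 2 * enorm (w - x) ^+ 2).
  rewrite (_ : x - _ - w = - (c^-1 *: g + (w - x))); last first.
    by rewrite opprD opprB addrAC addrC.
  rewrite -scaleN1r enormZ normrN1 mul1r sqr_enormD dotpZl.
  by field; rewrite gt_eqF.
by rewrite !E lerD2l ler_pM2l// divr_gt0.
Qed.

(** * The objective: gradient, curvature bounds and one-step decrease *)

Section Objective.
Variables (n m : nat) (a : 'M[R]_(n, m)) (B : 'cV[R]_n).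
Hypothesis a_row : forall i, exists j, a i j != 0.
Hypothesis B_gt0 : forall i, 0 < B i 0.

Let F := Fobj a B.
Let dh i := dhtilde_i (B i 0) (rlow a B i).

Lemma rlow_gt0 i : 0 < rlow a B i.
Proof. by have [j /rowinf_gt0 aij] := a_row i; rewrite mulr_gt0. Qed.

Lemma rlow_le_rbar i : rlow a B i <= rbar a B i.
Proof.
have [j /rowinf_gt0 aij] := a_row i.
by rewrite /rlow /rbar ler_pM2r// ler_norm1.
Qed.

Lemma grad_Fobj (p : 'cV[R]_m) j :
  grad F p j 0 = \sum_i dh i ((a *m p) i 0) * a i j.
Proof.
rewrite mxE derive1E; apply: derive_val.
pose l i (s : R) := (a *m p) i 0 + s * a i j.
have -> : (fun s : R => F (p + s *: delta_mx j 0)) =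
    \sum_i (htilde_i (B i 0) (rlow a B i) \o l i).
  apply/funext => s; rewrite fct_sumE; apply: eq_bigr => i _ /=.
  by rewrite mulmxDr -scalemxAr -colE /l !mxE.
apply: is_derive_sum => i.
have lD : is_derive (0 : R) (1 : R) (l i) (a i j).
  have -> : l i = cst ((a *m p) i 0) + (a i j) \*: id.
    by apply/funext => s; rewrite /l !fctE /= mulrC.
  by apply: is_derive_eq; rewrite add0r /GRing.scale /= mulr1.
have hD : is_derive (l i 0) (1 : R) (htilde_i (B i 0) (rlow a B i))
    (dh i ((a *m p) i 0)).
  by rewrite /l mul0r addr0; exact: is_derive_htilde_i (rlow_gt0 i).
exact: is_derive1_comp.
Qed.

(** Exchanging the sums expresses the pairing row by row, so inequalities for [F] reduce to scalar
    ones for each coordinate of the image. *)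
Lemma dotp_grad_Fobj (p d : 'cV[R]_m) :
  dotp (grad F p) d = \sum_i dh i ((a *m p) i 0) * (a *m d) i 0.
Proof.
rewrite /dotp; under eq_bigr do rewrite grad_Fobj mulr_suml.
rewrite exchange_big; apply: eq_bigr => i _ /=.
by rewrite [(a *m d) i 0]mxE mulr_sumr; apply: eq_bigr => j _; rewrite mulrA.
Qed.

(** The index [i] witnesses that there is a row; the supremum of an empty family would be 0. *)
Lemma L_const_gt0 (i : 'I_n) : 0 < L_const a B.
Proof.
apply: lt_le_trans (ler_L_const a B i).
by rewrite divr_gt0// exprn_gt0// rlow_gt0.
Qed.

Lemma Fobj_smooth (i0 : 'I_n) (x y : 'cV[R]_m) :
  F y <= F x + dotp (grad F x) (y - x)
    + L_const a B * specnorm a ^+ 2 / 2 * enorm (y - x) ^+ 2.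
Proof.
apply: (@le_trans _ _ (F x + dotp (grad F x) (y - x)
    + L_const a B / 2 * enorm (a *m (y - x)) ^+ 2)); last first.
  rewrite lerD2l.
  have L0 := L_const_gt0 i0.
  rewrite (_ : L_const a B * _ / 2 * _ =
    L_const a B / 2 * (specnorm a * enorm (y - x)) ^+ 2); last by field.
  rewrite ler_wpM2l ?divr_ge0 ?(ltW L0)// ler_sqr ?nnegrE ?enorm_ge0//.
    exact: enorm_mulmx_le.
  exact: le_trans (enorm_ge0 _) (enorm_mulmx_le _ _).
rewrite dotp_grad_Fobj sqr_enorm mulr_sumr /F /Fobj /htilde -!big_split /=.
apply: ler_sum => i _; rewrite mulmxBr.
rewrite (_ : (a *m y - a *m x) i 0 = (a *m y) i 0 - (a *m x) i 0);
  last by rewrite !mxE.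
apply: le_trans (htilde_i_smooth ((a *m x) i 0) _ (B_gt0 i) (rlow_gt0 i)) _.
by rewrite lerD2l ler_wpM2r ?sqr_ge0// ler_wpM2r ?invr_ge0// ler_L_const.
Qed.

(** The quadratic term only sees [a *m (y - x)], as [F] is constant along the kernel of [a]; the
    Hoffman bound will compensate for this. *)
Lemma Fobj_strongly_convex (x y : 'cV[R]_m) : Pset B x -> Pset B y ->
  F x + dotp (grad F x) (y - x) + mu_const a B / 2 * enorm (a *m (y - x)) ^+ 2
    <= F y.
Proof.
move=> Px Py.
rewrite dotp_grad_Fobj sqr_enorm mulr_sumr /F /Fobj /htilde -!big_split /=.
apply: ler_sum => i _.
have := htilde_i_strongly_convex (B_gt0 i) (rlow_gt0 i) (rlow_le_rbar i)
  (mulmx_Pset_le a i Px) (mulmx_Pset_le a i Py).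
apply: le_trans; rewrite mulmxBr.
rewrite (_ : (a *m y - a *m x) i 0 = (a *m y) i 0 - (a *m x) i 0);
  last by rewrite !mxE.
by rewrite lerD2l ler_wpM2r ?sqr_ge0// ler_wpM2r ?invr_ge0// mu_const_le.
Qed.

Lemma Pset_segment (x y : 'cV[R]_m) (s : R) : 0 <= s <= 1 ->
  Pset B x -> Pset B y -> Pset B (x + s *: (y - x)).
Proof.
move=> s01 [x0 xB] [y0 yB]; split => [j|].
  by rewrite !mxE; have := x0 j; have := y0 j; nra.
by rewrite sum_coordDZ sum_coordB xB yB subrr mulr0 addr0.
Qed.

Lemma projected_gradient_step (i0 : 'I_n) (x q z : 'cV[R]_m) :
  Pset B x -> Pset B q ->
  is_proj (@Pset R n m B)
    (x - (L_const a B * specnorm a ^+ 2)^-1 *: grad F x) z ->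
  F z - F q <=
  (1 - mu_const a B / Num.max (mu_const a B)
     (L_const a B * hoffman (@Pset R n m B) a ^+ 2 * specnorm a ^+ 2))
  * (F x - F q).
Proof.
move=> Px Pq zproj.
set L := L_const a B in zproj *; set N := specnorm a in zproj *.
set mu := mu_const a B; set H := hoffman _ a; set M := Num.max _ _.
have L0 : 0 < L := L_const_gt0 i0.
have N0 : 0 < N by have [j /specnorm_gt0] := a_row i0.
have mu0 : 0 <= mu by exact: mu_const_ge0.
have LN0 : 0 < L * N ^+ 2 by rewrite mulr_gt0 ?exprn_gt0.
have muM : mu <= M by rewrite le_max lexx.
have LM : L * H ^+ 2 * N ^+ 2 <= M by rewrite le_max lexx orbT.
(* As [mu0] gives only [0 <= mu], the case [M = 0] is treated apart; there [s = 0] since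
   [0^-1 = 0]. *)
set s := mu / M.
have s01 : 0 <= s <= 1.
  rewrite divr_ge0 ?(le_trans mu0)//=.
  have [M0|M0] := eqVneq M 0; first by rewrite /s M0 invr0 mulr0.
  by rewrite ler_pdivrMr ?mul1r// lt_neqAle eq_sym M0 (le_trans mu0).
have [y yproj] := is_proj_Pset_exists a x Pq.
have [[Py ay] _] := yproj.
(* The comparison point [q] may be replaced by [y], to which the Hoffman bound applies. *)
have Fy : F y = F q by rewrite /F /Fobj ay.
have xy : enorm (y - x) <= H * enorm (a *m (y - x)).
  rewrite enormB mulmxBr ay [X in _ * X]enormB.
  exact: hoffmanP (Pset_hoffman_prop a B) Pq Px yproj.
(* The choice of [s] gives [s * (L * H ^+ 2 * N ^+ 2) <= mu], because [M] dominates the product in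
   parentheses. *)
have growth : L * N ^+ 2 * s * enorm (y - x) ^+ 2 <=
    mu * enorm (a *m (y - x)) ^+ 2.
  have [M0|M0] := eqVneq M 0.
    by rewrite /s M0 invr0 mulr0 mulr0 mul0r mulr_ge0 ?sqr_ge0.
  have {}M0 : 0 < M by rewrite lt_neqAle eq_sym M0 (le_trans mu0).
  apply: (@le_trans _ _ (L * N ^+ 2 * s * (H * enorm (a *m (y - x))) ^+ 2)).
    apply: ler_wpM2l; first by apply: mulr_ge0 (ltW LN0) _; case/andP: s01.
    by rewrite ler_sqr ?nnegrE ?mulr_ge0 ?enorm_ge0 ?hoffman_ge0.
  rewrite (_ : L * _ * s * _ = (L * H ^+ 2 * N ^+ 2 / M) *
    (mu * enorm (a *m (y - x)) ^+ 2)); last first.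
    by rewrite /s; field; rewrite gt_eqF.
  apply: ler_piMl; first by rewrite mulr_ge0 ?sqr_ge0.
  by rewrite ler_pdivrMr// mul1r.
have := Fobj_smooth i0 x z.
have := is_proj_model_min LN0 zproj (Pset_segment s01 Px Py).
have := Fobj_strongly_convex Px Py.
rewrite Fy [x + _]addrC addrK dotpZr enormZ exprMn.
rewrite real_normK ?num_real// -/L -/N -/mu.
set D := dotp _ (y - x); set Dz := dotp _ (z - x).
set e := enorm (y - x) ^+ 2 in growth *.
set ez := enorm (z - x) ^+ 2; set ea := enorm (a *m _) ^+ 2 in growth *.
set K := L * N ^+ 2 in growth *.
case/andP: s01 => s0 s1 sc mn sm.
(* Both [sc] and [growth] are scaled by [s]: the first bounds [s * D], the second absorbs the term
   [K / 2 * s ^+ 2 * e] of the model at the test point. *)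
have := ler_wpM2l s0 sc; have := ler_wpM2l s0 growth.
have -> : (1 - s) * (F x - F q) = F x - s * F x - F q + s * F q by ring.
nra.
Qed.

End Objective.
End ProjectedGradient.


(** * Linear rate by iterating the one-step contraction *)

Theorem theorem8 (R : realType) (n m : nat) (a : 'M[R]_(n, m)) (B : 'cV[R]_n)
  (Fstar : R) (p : nat -> 'cV[R]_m) :
  (forall i j, 0 <= a i j) ->
  (forall i : 'I_n, exists j, a i j != 0) ->
  (forall j : 'I_m, exists i, a i j != 0) ->
  (forall i, 0 < B i 0) ->
  (exists q, @Pset R n m B q /\ Fobj a B q = Fstar) ->
  (forall q, @Pset R n m B q -> Fstar <= Fobj a B q) ->
  @Pset R n m B (p 0%N) ->
  (forall t : nat, is_proj (@Pset R n m B) 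
      (p t - (L_const a B * specnorm a ^+ 2)^-1 *: grad (Fobj a B) (p t))
      (p t.+1)) ->
  forall t : nat,
    Fobj a B (p t) - Fstar <=
    (1 - mu_const a B /
           Num.max (mu_const a B)
             (L_const a B * hoffman (@Pset R n m B) a ^+ 2 * specnorm a ^+ 2)) ^+ t
    * (Fobj a B (p 0%N) - Fstar).
Proof.
move=> _ a_row _ B0 [q [Pq <-]] _ P0 pS t.
(* The one-step bound takes a row index; without rows [F] is an empty sum and both sides are 0. *)
case: n a B a_row B0 q Pq P0 pS => [|n'] a B a_row B0 q Pq P0 pS.
  by rewrite /Fobj /htilde !big_ord0 subrr mulr0.
have PP u : Pset B (p u) by case: u => // u; case: (pS u).
elim: t => [|t IH]; first by rewrite expr0 mul1r.
apply: le_trans (projected_gradient_step a_row B0 ord0 (PP t) Pq (pS t)) _.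
(* The induction hypothesis is multiplied by the contraction factor, which is nonnegative since
   [mu_const a B <= M]. *)
rewrite [_ ^+ t.+1]exprS -[leRHS]mulrA ler_wpM2l// subr_ge0.
have mu0 := mu_const_ge0 a B0.
set M := Num.max _ _; have muM : mu_const a B <= M by rewrite le_max lexx.
have [->|M0] := eqVneq M 0; first by rewrite invr0 mulr0.
by rewrite ler_pdivrMr ?mul1r// lt_neqAle eq_sym M0 (le_trans mu0).
Qed.
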